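(* The equivalent algebraic semantics of $L_{\rm LEA}$ (with respect to equivalence formulas $\{p\rightarrow q,q\rightarrow p\}$ and defining identity $p\approx p\rightarrow p$) is the quasivariety of algebras $(I,\rightarrow,0)$ of type $(2,0)$ axiomatized by the following identities and quasiidentities, where $x':=x\rightarrow0$ and $1:=0'$: (1) $x\rightarrow(y\rightarrow x)\approx1$; (2) $((x\rightarrow y)\rightarrow y)\rightarrow((y\rightarrow x)\rightarrow x)\approx1$; (3) $0\rightarrow x\approx1$; (4) $x\rightarrow x\approx1$; (5) if $x=1$ and $x\rightarrow y=1$ then $y=1$; (6) if $x\rightarrow y=1$ then $(y\rightarrow z)\rightarrow(x\rightarrow z)=1$; (7) if $x\rightarrow y=1$ then $(x'\rightarrow y')\rightarrow(y\rightarrow x)=1$; (8) if $x\rightarrow y=1$ and $y\rightarrow x=1$ then $x=y$; (9) if $x\rightarrow y'=1$ and $(x'\rightarrow y)\rightarrow z'=1$ then $((x'\rightarrow y)'\rightarrow z)\rightarrow(x'\rightarrow(y'\rightarrow z))=1$. Moreover, this quasivariety is exactly the class of lattice effect implication algebras.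
   Context: Formulas are built from propositional variables using a binary connective $\rightarrow$ and a constant $0$; $\neg\varphi:=\varphi\rightarrow0$. The logic $L_{\rm LEA}$ is the consequence relation $\vdash$ of the deductive system with axiom schemes (A1) $\varphi\rightarrow(\psi\rightarrow\varphi)$; (A2) $((\varphi\rightarrow\psi)\rightarrow\psi)\rightarrow((\psi\rightarrow\varphi)\rightarrow\varphi)$; (A3) $0\rightarrow\varphi$; and inference rules (MP) $\varphi,\varphi\rightarrow\psi\vdash\psi$; (Sf) $\varphi\rightarrow\psi\vdash(\psi\rightarrow\chi)\rightarrow(\varphi\rightarrow\chi)$; (WPf) $\varphi\rightarrow\psi,\psi\rightarrow\varphi\vdash(\chi\rightarrow\varphi)\rightarrow(\chi\rightarrow\psi)$; (R1) $\varphi\rightarrow\psi\vdash(\neg\varphi\rightarrow\neg\psi)\rightarrow(\psi\rightarrow\varphi)$; (R2) $\varphi\rightarrow\neg\psi,(\neg\varphi\rightarrow\psi)\rightarrow\neg\chi\vdash(\neg(\neg\varphi\rightarrow\psi)\rightarrow\chi)\rightarrow(\neg\varphi\rightarrow(\neg\psi\rightarrow\chi))$. A class $\mathcal K$ of algebras is an equivalent algebraic semantics of a deductive system $\vdash$ with equivalence formulas $\Delta(p,q)$ and defining identity $\delta(p)\approx\varepsilon(p)$ if (1) $\Gamma\vdash\varphi$ iff $\{\delta(\psi)\approx\varepsilon(\psi):\psi\in\Gamma\}\models_{\mathcal K}\delta(\varphi)\approx\varepsilon(\varphi)$ for all $\Gamma\cup\{\varphi\}$, and (2) $\varphi\approx\psi$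 and $\{\delta(\chi)\approx\varepsilon(\chi):\chi\in\Delta(\varphi,\psi)\}$ are mutually $\mathcal K$-consequences of each other; here $\Sigma\models_{\mathcal K}s\approx t$ means every assignment in every member of $\mathcal K$ satisfying $\Sigma$ satisfies $s\approx t$. The equivalent algebraic semantics which is a quasivariety is unique. A lattice effect implication algebra is an algebra $(I,\rightarrow,0)$ such that, with $x':=x\rightarrow0$ and $1:=0'$, for all $x,y,z\in I$: (i) $0\rightarrow x=x\rightarrow x=x\rightarrow1=1$; (ii) if $x\rightarrow y=y\rightarrow x=1$ then $x=y$; (iii) if $x\rightarrow y=y\rightarrow z=1$ then $x\rightarrow z=1$; (iv) if $x\rightarrow y=1$ then $y'\rightarrow x'=1$; (v) $x''=x$; (vi) $x\rightarrow((x\rightarrow y)\rightarrow y)=1$; (vii) $y\rightarrow((x\rightarrow y)\rightarrow y)=1$; (viii) if $x\rightarrow z=y\rightarrow z=1$ then $((x\rightarrow y)\rightarrow y)\rightarrow z=1$; (ix) if $x\rightarrow y=1$ then $y\rightarrow x=x'\rightarrow y'$; (x) [$x\rightarrow y'=1$ and $(x'\rightarrow y)\rightarrow z'=1$] if and only if [$y\rightarrow z'=1$ and $x\rightarrow(y'\rightarrow z)'=1$], and in this case $(x'\rightarrow y)'\rightarrow z=x'\rightarrow(y'\rightarrow z)$; (xi) $y'\rightarrow((x\rightarrow y)\rightarrow y)'=x\rightarrow y$; (xii) $x\rightarrow(y\rightarrow x)=1$. *)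

(* Defs.v *)
From Stdlib Require Import List.
Import ListNotations.

Set Implicit Arguments.
Unset Strict Implicit.
Unset Printing Implicit Defensive.

(* Propositional formulas and algebraic terms are the same objects; [V] is the
   set of variables. *)
Inductive term (V : Type) : Type :=
| Var (v : V)
| Imp (s t : term V)
| Zero.
Arguments Zero {V}.

Declare Scope term_scope.
Delimit Scope term_scope with term.
Bind Scope term_scope with term.
Notation "s ~> t" := (Imp s t) (at level 55, right associativity) : term_scope.
Definition neg {V : Type} (t : term V) : term V := Imp t Zero.
Notation "¬ t" := (neg t) (at level 35, right associativity) : term_scope.
Notation "1" := (neg Zero) : term_scope.

Fixpoint subst (V W : Type) (h : V -> term W) (t : term V) : term W :=
  match t with
  | Var v => h v
  | Imp s u => Imp (subst h s) (subst h u)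
  | Zero => Zero
  end.

Notation formula := (term nat).

Record algebra : Type := Algebra {
  carrier :> Type;
  imp : carrier -> carrier -> carrier;
  zero : carrier
}.
Arguments imp {a} _ _.
Arguments zero {a}.

Fixpoint eval (A : algebra) (V : Type) (a : V -> A) (t : term V) : A :=
  match t with
  | Var v => a v
  | Imp s u => imp (eval a s) (eval a u)
  | Zero => zero
  end.

Record equation : Type := Equation { lhs : formula; rhs : formula }.
Notation "s ≈ t" := (Equation s%term t%term) (at level 70, no associativity).

Definition satisfies (A : algebra) (a : nat -> A) (e : equation) : Prop :=
  eval a (lhs e) = eval a (rhs e).

Definition eq_consequence (K : algebra -> Prop)
    (Sigma : equation -> Prop) (e : equation) : Prop :=
  forall A : algebra, K A -> forall a : nat -> A,
    (forall e', Sigma e' -> satisfies a e') -> satisfies a e.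

(* An identity is a quasiidentity without premises. *)
Record quasiidentity : Type := Quasiidentity {
  premises : list equation;
  conclusion : equation
}.
Notation "ps ⟹ e" := (Quasiidentity ps e) (at level 75, no associativity).

Definition holds_in (A : algebra) (q : quasiidentity) : Prop :=
  forall a : nat -> A,
    (forall e, In e (premises q) -> satisfies a e) -> satisfies a (conclusion q).

Definition Mod (Ax : quasiidentity -> Prop) (A : algebra) : Prop :=
  forall q, Ax q -> holds_in A q.

Definition is_quasivariety (K : algebra -> Prop) : Prop :=
  exists Ax : quasiidentity -> Prop, forall A, K A <-> Mod Ax A.

(* The defining identity is a pair of terms in one variable, hence over [unit];
   the equivalence formulas are terms in two variables p, q, hence over [bool]
   with p := true and q := false. *)
Definition subst1 (phi : formula) (t : term unit) : formula :=
  subst (fun _ => phi) t.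

Definition subst2 (phi psi : formula) (t : term bool) : formula :=
  subst (fun b : bool => if b then phi else psi) t.

Definition translate (delta epsilon : term unit) (phi : formula) : equation :=
  subst1 phi delta ≈ subst1 phi epsilon.

Definition translate_set (delta epsilon : term unit) (Gamma : formula -> Prop) :
    equation -> Prop :=
  fun e => exists psi, Gamma psi /\ e = translate delta epsilon psi.

Definition equivalence_set (Delta : list (term bool)) (phi psi : formula) :
    formula -> Prop :=
  fun chi => exists t, In t Delta /\ chi = subst2 phi psi t.

Record equivalent_algebraic_semantics
    (derives : (formula -> Prop) -> formula -> Prop)
    (Delta : list (term bool)) (delta epsilon : term unit)
    (K : algebra -> Prop) : Prop := {
  eas_consequence : forall (Gamma : formula -> Prop) (phi : formula),
    derives Gamma phi <->
    eq_consequence K (translate_set delta epsilon Gamma)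
                     (translate delta epsilon phi);
  eas_eq_to_equivalence : forall phi psi e,
    translate_set delta epsilon (equivalence_set Delta phi psi) e ->
    eq_consequence K (fun e' => e' = (phi ≈ psi)) e;
  eas_equivalence_to_eq : forall phi psi,
    eq_consequence K
      (translate_set delta epsilon (equivalence_set Delta phi psi)) (phi ≈ psi)
}.

Section Logic.
Local Open Scope term_scope.

Inductive L_LEA (Gamma : formula -> Prop) : formula -> Prop :=
| L_hyp phi : Gamma phi -> L_LEA Gamma phi
| L_A1 phi psi : L_LEA Gamma (phi ~> (psi ~> phi))
| L_A2 phi psi :
    L_LEA Gamma (((phi ~> psi) ~> psi) ~> ((psi ~> phi) ~> phi))
| L_A3 phi : L_LEA Gamma (Zero ~> phi)
| L_MP phi psi :
    L_LEA Gamma phi -> L_LEA Gamma (phi ~> psi) -> L_LEA Gamma psi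
| L_Sf phi psi chi :
    L_LEA Gamma (phi ~> psi) ->
    L_LEA Gamma ((psi ~> chi) ~> (phi ~> chi))
| L_WPf phi psi chi :
    L_LEA Gamma (phi ~> psi) -> L_LEA Gamma (psi ~> phi) ->
    L_LEA Gamma ((chi ~> phi) ~> (chi ~> psi))
| L_R1 phi psi :
    L_LEA Gamma (phi ~> psi) ->
    L_LEA Gamma ((¬ phi ~> ¬ psi) ~> (psi ~> phi))
| L_R2 phi psi chi :
    L_LEA Gamma (phi ~> ¬ psi) ->
    L_LEA Gamma ((¬ phi ~> psi) ~> ¬ chi) ->
    L_LEA Gamma
      ((¬ (¬ phi ~> psi) ~> chi) ~> (¬ phi ~> (¬ psi ~> chi))).

Definition LEA_Delta : list (term bool) :=
  [Var true ~> Var false; Var false ~> Var true].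
Definition LEA_delta : term unit := Var tt.
Definition LEA_epsilon : term unit := Var tt ~> Var tt.

End Logic.

Definition LEA_quasiidentities : list quasiidentity :=
  let x : formula := Var 0 in
  let y : formula := Var 1 in
  let z : formula := Var 2 in
  [ [] ⟹ x ~> (y ~> x) ≈ 1;
    [] ⟹ ((x ~> y) ~> y) ~> ((y ~> x) ~> x) ≈ 1;
    [] ⟹ Zero ~> x ≈ 1;
    [] ⟹ x ~> x ≈ 1;
    [x ≈ 1; x ~> y ≈ 1] ⟹ y ≈ 1;
    [x ~> y ≈ 1] ⟹ (y ~> z) ~> (x ~> z) ≈ 1;
    [x ~> y ≈ 1] ⟹ (¬ x ~> ¬ y) ~> (y ~> x) ≈ 1;
    [x ~> y ≈ 1; y ~> x ≈ 1] ⟹ x ≈ y;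
    [x ~> ¬ y ≈ 1; (¬ x ~> y) ~> ¬ z ≈ 1] ⟹
      (¬ (¬ x ~> y) ~> z) ~> (¬ x ~> (¬ y ~> z)) ≈ 1 ].

Definition LEA_quasivariety : algebra -> Prop :=
  Mod (fun q => In q LEA_quasiidentities).

Declare Scope alg_scope.
Delimit Scope alg_scope with alg.
Notation "x ~> y" := (imp x y) (at level 55, right associativity) : alg_scope.
Definition compl {A : algebra} (x : A) : A := imp x zero.
Definition one {A : algebra} : A := compl zero.
Notation "x ^'" := (compl x) (at level 2, format "x ^'") : alg_scope.
Notation "1" := one : alg_scope.

Section LEIA.
Local Open Scope alg_scope.

Record lattice_effect_implication_algebra (I : algebra) : Prop := {
  leia_i : forall x : I, zero ~> x = 1 /\ x ~> x = 1 /\ x ~> 1 = 1;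
  leia_ii : forall x y : I, x ~> y = 1 -> y ~> x = 1 -> x = y;
  leia_iii : forall x y z : I, x ~> y = 1 -> y ~> z = 1 -> x ~> z = 1;
  leia_iv : forall x y : I, x ~> y = 1 -> y^' ~> x^' = 1;
  leia_v : forall x : I, x^'^' = x;
  leia_vi : forall x y : I, x ~> ((x ~> y) ~> y) = 1;
  leia_vii : forall x y : I, y ~> ((x ~> y) ~> y) = 1;
  leia_viii : forall x y z : I,
    x ~> z = 1 -> y ~> z = 1 -> ((x ~> y) ~> y) ~> z = 1;
  leia_ix : forall x y : I, x ~> y = 1 -> y ~> x = x^' ~> y^';
  leia_x : forall x y z : I,
    ((x ~> y^' = 1 /\ (x^' ~> y) ~> z^' = 1) <->
     (y ~> z^' = 1 /\ x ~> (y^' ~> z)^' = 1)) /\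
    ((x ~> y^' = 1 /\ (x^' ~> y) ~> z^' = 1) ->
     (x^' ~> y)^' ~> z = x^' ~> (y^' ~> z));
  leia_xi : forall x y : I, y^' ~> ((x ~> y) ~> y)^' = x ~> y;
  leia_xii : forall x y : I, x ~> (y ~> x) = 1
}.

End LEIA.

(* Main.v *)
(* Soundness and the description of the quasivariety by effect implication
   algebras are computations with the order [x <= y iff x ~> y = 1], in which
   [(x ~> y) ~> y] is the join and [x^' ~> y] is the partial sum of orthogonal
   elements ([x <= y^']), commutative because [x <= y] implies
   [y ~> x = x^' ~> y^'].  Completeness comes from the Lindenbaum algebra of
   [Gamma].  For uniqueness, a quasiidentity holds in an equivalent algebraic
   semantics iff the equivalence formulas of its conclusion are derivable from
   those of its premises, so two such classes satisfy the same
   quasiidentities. *)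
From Stdlib Require Import List FunctionalExtensionality PropExtensionality.
From Stdlib Require Import ClassicalEpsilon ProofIrrelevance.
Require Import Defs.
Import ListNotations.

Set Implicit Arguments.
Unset Strict Implicit.
Unset Printing Implicit Defensive.

(** * Uniqueness of the quasivariety semantics *)

Section UniqueSemantics.

Variables (derives : (formula -> Prop) -> formula -> Prop)
  (Delta : list (term bool)) (delta epsilon : term unit).

Definition premise_equivalences (ps : list equation) : formula -> Prop :=
  fun chi => exists e, In e ps /\ equivalence_set Delta (lhs e) (rhs e) chi.

Lemma satisfies_equivalence K (A : algebra) (a : nat -> A) s t :
  equivalent_algebraic_semantics derives Delta delta epsilon K -> K A ->
  satisfies a (s ≈ t) <->
  forall chi, equivalence_set Delta s t chi ->
    satisfies a (translate delta epsilon chi).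
Proof.
intros eas KA; split.
- intros st chi Hchi.
  apply (eas_eq_to_equivalence eas (phi := s) (psi := t)); trivial.
  + now exists chi.
  + now intros e' ->.
- intros H; apply (eas_equivalence_to_eq eas); trivial.
  intros e' [chi [Hchi ->]]; auto.
Qed.

(** Equations and sets of translated equivalence formulas are interchangeable in [K], so validity of
    [q] becomes an instance of condition (1). The right-hand side does not mention [K], which is
    what gives uniqueness. *)
Lemma holds_in_derives K q :
  equivalent_algebraic_semantics derives Delta delta epsilon K ->
  (forall A, K A -> holds_in A q) <->
  forall chi,
    equivalence_set Delta (lhs (conclusion q)) (rhs (conclusion q)) chi ->
    derives (premise_equivalences (premises q)) chi.
Proof.
intros eas; destruct q as [ps [s t]]; simpl; split.
- intros H chi Hchi; apply (eas_consequence eas).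
  intros A KA a Ha.
  apply (proj1 (satisfies_equivalence a s t eas KA)); trivial.
  apply H; trivial; intros [u v] Hin.
  apply (satisfies_equivalence a u v eas KA); intros psi Hpsi.
  apply Ha; exists psi; split; trivial; now exists (u ≈ v).
- intros H A KA a Ha.
  apply (satisfies_equivalence a s t eas KA); intros chi Hchi.
  apply (proj1 (eas_consequence eas _ _) (H chi Hchi) A KA).
  intros e [psi [[[u v] [Hin Hpsi]] ->]].
  apply (proj1 (satisfies_equivalence a u v eas KA)); trivial.
  now apply Ha.
Qed.

Lemma quasivariety_semantics_sub K L :
  is_quasivariety L ->
  equivalent_algebraic_semantics derives Delta delta epsilon K ->
  equivalent_algebraic_semantics derives Delta delta epsilon L ->
  forall A, K A -> L A.
Proof.
intros [Ax HL] easK easL A KA; apply HL; intros q Hq.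
apply (proj2 (holds_in_derives q easK)); trivial.
apply (proj1 (holds_in_derives q easL)).
intros B LB; now apply (proj1 (HL B) LB).
Qed.

End UniqueSemantics.

(** * Elementwise form of the axioms (1)-(9) *)

Section FirstOrderForm.
Local Open Scope alg_scope.

Record LEA_algebra (A : algebra) : Prop := {
  lea_K : forall x y : A, x ~> (y ~> x) = 1;
  lea_join : forall x y : A, ((x ~> y) ~> y) ~> ((y ~> x) ~> x) = 1;
  lea_zero : forall x : A, zero ~> x = 1;
  lea_refl : forall x : A, x ~> x = 1;
  lea_mp : forall x y : A, x = 1 -> x ~> y = 1 -> y = 1;
  lea_suffix : forall x y z : A, x ~> y = 1 -> (y ~> z) ~> (x ~> z) = 1;
  lea_contra : forall x y : A, x ~> y = 1 -> (x^' ~> y^') ~> (y ~> x) = 1;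
  lea_antisym : forall x y : A, x ~> y = 1 -> y ~> x = 1 -> x = y;
  lea_sum : forall x y z : A, x ~> y^' = 1 -> (x^' ~> y) ~> z^' = 1 ->
    ((x^' ~> y)^' ~> z) ~> (x^' ~> (y^' ~> z)) = 1
}.

Lemma LEA_quasivarietyE A : LEA_quasivariety A <-> LEA_algebra A.
Proof.
split.
- intros H.
  (* The assignment [a] sends the variables 0, 1, 2 to [x], [y], [z]; the bound on [i] keeps [nth]
     away from its default. *)
  assert (inst : forall i, i < length LEA_quasiidentities -> forall x y z : A,
    let q := nth i LEA_quasiidentities ([] ⟹ Zero ≈ Zero) in
    let a := fun n => match n with 0 => x | S 0 => y | _ => z end in
    (forall e, In e (premises q) -> satisfies a e) ->
    satisfies a (conclusion q))
    by (intros i Hi x y z q a; now apply H, nth_In).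
  simpl length in inst; split.
  + intros x y; apply (inst 0%nat ltac:(repeat constructor) x y x); intros _ [].
  + intros x y; apply (inst 1%nat ltac:(repeat constructor) x y x); intros _ [].
  + intros x; apply (inst 2%nat ltac:(repeat constructor) x x x); intros _ [].
  + intros x; apply (inst 3%nat ltac:(repeat constructor) x x x); intros _ [].
  + intros x y x1 xy; apply (inst 4%nat ltac:(repeat constructor) x y x).
    now intros _ [<-|[<-|[]]].
  + intros x y z xy; apply (inst 5%nat ltac:(repeat constructor) x y z).
    now intros _ [<-|[]].
  + intros x y xy; apply (inst 6%nat ltac:(repeat constructor) x y x).
    now intros _ [<-|[]].
  + intros x y xy yx; apply (inst 7%nat ltac:(repeat constructor) x y x).
    now intros _ [<-|[<-|[]]].
  + intros x y z xy xyz; apply (inst 8%nat ltac:(repeat constructor) x y z).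
    now intros _ [<-|[<-|[]]].
- intros H q Hq a; simpl in Hq.
  destruct Hq as [<-|[<-|[<-|[<-|[<-|[<-|[<-|[<-|[<-|[]]]]]]]]]]; intros prem.
  + apply (lea_K H).
  + apply (lea_join H).
  + apply (lea_zero H).
  + apply (lea_refl H).
  + assert (p := prem _ (or_introl eq_refl)).
    assert (p' := prem _ (or_intror (or_introl eq_refl))).
    exact (lea_mp H p p').
  + assert (p := prem _ (or_introl eq_refl)).
    exact (lea_suffix H _ p).
  + assert (p := prem _ (or_introl eq_refl)).
    exact (lea_contra H p).
  + assert (p := prem _ (or_introl eq_refl)).
    assert (p' := prem _ (or_intror (or_introl eq_refl))).
    exact (lea_antisym H p p').
  + assert (p := prem _ (or_introl eq_refl)).
    assert (p' := prem _ (or_intror (or_introl eq_refl))).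
    exact (lea_sum H p p').
Qed.

End FirstOrderForm.

(** * From the axioms (1)-(9) to lattice effect implication algebras *)

Section LatticeEffectImplication.
Local Open Scope alg_scope.
Variable A : algebra.
Implicit Types x y z : A.

Section FromLEA.
Hypothesis H : LEA_algebra A.

Lemma lea_trans x y z : x ~> y = 1 -> y ~> z = 1 -> x ~> z = 1.
Proof.
intros xy yz; exact (lea_mp H yz (lea_suffix H z xy)).
Qed.

Lemma lea_top x : x ~> 1 = 1.
Proof. exact (lea_mp H eq_refl (lea_K H 1 x)). Qed.

Lemma lea_joinC x y : (x ~> y) ~> y = (y ~> x) ~> x.
Proof. apply (lea_antisym H); apply (lea_join H). Qed.

Lemma lea_unit x : 1 ~> x = x.
Proof.
apply (lea_antisym H); [|apply (lea_K H)].
apply (lea_mp H eq_refl).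
(* The leading [1] is expanded to [(x ~> 1) ~> 1], which makes the goal an instance of (2). *)
rewrite <- (lea_refl H 1) at 1; rewrite <- (lea_top x) at 1.
apply (lea_join H).
Qed.

(** The double complement is the join of [x] with [zero], hence equals [1 ~> x]. *)
Lemma lea_complK x : x^'^' = x.
Proof.
unfold compl; rewrite lea_joinC, (lea_zero H); apply lea_unit.
Qed.

Lemma lea_compl_le x y : x ~> y = 1 -> y^' ~> x^' = 1.
Proof. apply (lea_suffix H). Qed.

Lemma lea_le_compl x y : x ~> y^' = 1 -> y ~> x^' = 1.
Proof. now intros xy; apply lea_compl_le in xy; rewrite lea_complK in xy. Qed.

Lemma lea_contraE x y : x ~> y = 1 -> y ~> x = x^' ~> y^'.
Proof.
intros xy; apply (lea_antisym H); [|now apply (lea_contra H)].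
(* The inequality converse to (7) is (7) itself for [y^' <= x^'], up to double complements. *)
rewrite <- (lea_complK x) at 1; rewrite <- (lea_complK y) at 1.
now apply (lea_contra H), lea_compl_le.
Qed.

Lemma lea_sumC x y : x ~> y^' = 1 -> x^' ~> y = y^' ~> x.
Proof. now intros xy; rewrite (lea_contraE xy), lea_complK. Qed.

Lemma lea_le_join x y z :
  x ~> z = 1 -> y ~> z = 1 -> ((x ~> y) ~> y) ~> z = 1.
Proof.
intros xz yz.
(* Suffixing [x <= z] with [y] twice bounds the join of [x] and [y] by that of [z] and [y], which is
   [z] because [y <= z]. *)
enough (zE : (z ~> y) ~> y = z)
  by (rewrite <- zE; now apply (lea_suffix H), (lea_suffix H)).
now rewrite lea_joinC, yz, lea_unit.
Qed.

(** First, [y <= x^' ~> y <= z^']. Second, [y^' ~> z = z^' ~> y] lies below [(x^' ~> y) ~> y], the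
    join of [x^'] and [y], and this is below [x^'] since [y <= x^']. *)
Lemma lea_sum_orthogonal x y z :
  x ~> y^' = 1 -> (x^' ~> y) ~> z^' = 1 ->
  y ~> z^' = 1 /\ x ~> (y^' ~> z)^' = 1.
Proof.
intros xy xyz.
assert (yz : y ~> z^' = 1) by exact (lea_trans (lea_K H y (x^')) xyz).
split; trivial; apply lea_le_compl.
rewrite (lea_sumC yz).
apply lea_trans with ((x^' ~> y) ~> y); [now apply (lea_suffix H)|].
apply lea_le_join; [apply (lea_refl H)|now apply lea_le_compl].
Qed.

Lemma lea_sum_orthogonal_iff x y z :
  (x ~> y^' = 1 /\ (x^' ~> y) ~> z^' = 1) <->
  (y ~> z^' = 1 /\ x ~> (y^' ~> z)^' = 1).
Proof.
split; [intros [xy xyz]; now apply lea_sum_orthogonal|].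
intros [yz xyz].
(* The converse is the forward direction for [z, y, x], read through commutativity of the sums. *)
destruct (lea_sum_orthogonal (x := z) (y := y) (z := x)) as [yx zyx].
- now apply lea_le_compl.
- rewrite <- (lea_sumC yz); now apply lea_le_compl.
- assert (xy := lea_le_compl yx); split; trivial.
  rewrite (lea_sumC xy); now apply lea_le_compl.
Qed.

(* The converse of [lea_sum] is [lea_sum] itself for [z, y, x], up to
   commutativity of the partial sums. *)
Lemma lea_sumA x y z :
  x ~> y^' = 1 -> (x^' ~> y) ~> z^' = 1 ->
  (x^' ~> y)^' ~> z = x^' ~> (y^' ~> z).
Proof.
intros xy xyz; apply (lea_antisym H); [now apply (lea_sum H)|].
destruct (lea_sum_orthogonal xy xyz) as [yz xyz'].
rewrite (lea_sumC xyz'), (lea_sumC xyz), (lea_sumC yz), (lea_sumC xy).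
apply (lea_sum H); [now apply lea_le_compl|].
rewrite <- (lea_sumC yz); now apply lea_le_compl.
Qed.

Lemma LEA_algebra_leia : lattice_effect_implication_algebra A.
Proof.
split.
- intros x; split; [apply (lea_zero H)|split; [apply (lea_refl H)|]].
  apply lea_top.
- apply (lea_antisym H).
- apply lea_trans.
- apply lea_compl_le.
- apply lea_complK.
- intros x y; rewrite lea_joinC; apply (lea_K H).
- intros x y; apply (lea_K H).
- apply lea_le_join.
- apply lea_contraE.
- intros x y z; split; [apply lea_sum_orthogonal_iff|].
  intros [xy xyz]; now apply lea_sumA.
(* By contraposition the left side of (xi) is the join of [x ~> y] and [y], and [y <= x ~> y]. *)
- intros x y; rewrite <- (lea_contraE (lea_K H y (x ~> y))).
  now rewrite lea_joinC, (lea_K H), lea_unit.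
- apply (lea_K H).
Qed.

End FromLEA.

(** * From lattice effect implication algebras to the axioms (1)-(9) *)

Section FromLEIA.
Hypothesis H : lattice_effect_implication_algebra A.

Lemma leia_join_ge x y : x ~> y = 1 -> (y ~> x) ~> x = y.
Proof.
intros xy; apply (leia_ii H); [|apply (leia_vi H)].
apply (leia_viii H); trivial; apply (leia_i H).
Qed.

Lemma leia_sumC x y : x ~> y^' = 1 -> x^' ~> y = y^' ~> x.
Proof. now intros xy; rewrite (leia_ix H xy), (leia_v H). Qed.

Lemma leia_le_sum x y : x ~> y^' = 1 -> x ~> (x^' ~> y) = 1.
Proof. intros xy; rewrite (leia_sumC xy); apply (leia_xii H). Qed.

(* If [x <= y] then [y] is the sum of [x] and [(y ~> x)^'], so associativity
   exhibits [z^' ~> y] as a sum with first summand [z^' ~> x]. *)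
Lemma leia_sum_le x y z :
  x ~> y = 1 -> y ~> z^' = 1 -> (z^' ~> x) ~> (z^' ~> y) = 1.
Proof.
intros xy yz.
assert (yE : x^' ~> (y ~> x)^' = y)
  by (rewrite <- (leia_ix H (leia_xii H x y)); now apply leia_join_ge).
destruct (leia_x H z x ((y ~> x)^')) as [orth assoc].
assert (orth' : z ~> x^' = 1 /\ (z^' ~> x) ~> (y ~> x)^'^' = 1).
{ apply orth; rewrite yE; split.
  - rewrite (leia_v H); apply (leia_xii H).
  - now apply (leia_iv H) in yz; rewrite (leia_v H) in yz. }
assert (E := assoc orth'); rewrite yE in E; rewrite <- E.
now apply leia_le_sum.
Qed.

(** By (xi), [x ~> z] is the sum of [z] and the complement of the join of [x] and [z]. That
    complement is antitone in [x], and sums are monotone. *)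
Lemma leia_suffix x y z : x ~> y = 1 -> (y ~> z) ~> (x ~> z) = 1.
Proof.
intros xy; rewrite <- (leia_xi H x z), <- (leia_xi H y z).
apply leia_sum_le.
- apply (leia_iv H), (leia_viii H); [|apply (leia_vii H)].
  apply (leia_iii H xy), (leia_vi H).
- apply (leia_iv H), (leia_vii H).
Qed.

Lemma leia_LEA_algebra : LEA_algebra A.
Proof.
split.
- apply (leia_xii H).
- intros x y; apply (leia_viii H); [apply (leia_vii H)|apply (leia_vi H)].
- intros x; apply (leia_i H).
- intros x; apply (leia_i H).
- intros x y -> y1; apply (leia_ii H); [apply (leia_i H)|exact y1].
- apply leia_suffix.
- intros x y xy; rewrite (leia_ix H xy); apply (leia_i H).
- apply (leia_ii H).
- intros x y z xy xyz.
  rewrite (proj2 (leia_x H x y z) (conj xy xyz)); apply (leia_i H).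
Qed.

End FromLEIA.
End LatticeEffectImplication.

(** * Soundness of the logic *)

Lemma L_LEA_sound (Gamma : formula -> Prop) phi :
  L_LEA Gamma phi ->
  forall A, LEA_algebra A -> forall a : nat -> A,
    (forall psi, Gamma psi -> eval a psi = one) -> eval a phi = one.
Proof.
intros D A H a HG; induction D; simpl in *.
- now apply HG.
- apply (lea_K H).
- apply (lea_join H).
- apply (lea_zero H).
- exact (lea_mp H IHD1 IHD2).
- now apply (lea_suffix H).
(* For (WPf), antisymmetry gives the two formulas the same value. *)
- rewrite (lea_antisym H IHD1 IHD2); apply (lea_refl H).
- now apply (lea_contra H).
- now apply (lea_sum H).
Qed.

(** * The Lindenbaum algebra of a set of formulas *)

Section Lindenbaum.
Local Open Scope term_scope.
Variable Gamma : formula -> Prop.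
Implicit Types phi psi chi : formula.

Lemma L_trans phi psi chi :
  L_LEA Gamma (phi ~> psi) -> L_LEA Gamma (psi ~> chi) ->
  L_LEA Gamma (phi ~> chi).
Proof. intros D E; exact (L_MP E (L_Sf _ D)). Qed.

Lemma L_weaken phi psi : L_LEA Gamma phi -> L_LEA Gamma (psi ~> phi).
Proof. intros D; exact (L_MP D (L_A1 _ _ _)). Qed.

Lemma L_one : L_LEA Gamma 1.
Proof. apply L_A3. Qed.

(** Passes from [phi] to [1 ~> phi] by (A1) and back by (A2), whose antecedent [(phi ~> 1) ~> 1] is
    derivable by weakening. *)
Lemma L_refl phi : L_LEA Gamma (phi ~> phi).
Proof.
apply (L_trans (L_A1 _ phi 1)).
apply (L_MP (phi := (phi ~> 1) ~> 1)); [|apply L_A2].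
apply L_weaken, L_one.
Qed.

Definition interderivable phi psi :=
  L_LEA Gamma (phi ~> psi) /\ L_LEA Gamma (psi ~> phi).

Lemma interderivable_one phi : interderivable phi 1 <-> L_LEA Gamma phi.
Proof.
split; [intros [_ D]; exact (L_MP L_one D)|].
intros D; split; apply L_weaken; trivial; apply L_one.
Qed.

Lemma interderivable_sym phi psi :
  interderivable phi psi -> interderivable psi phi.
Proof. now intros [D E]. Qed.

Lemma interderivable_trans phi psi chi :
  interderivable phi psi -> interderivable psi chi -> interderivable phi chi.
Proof. intros [D D'] [E E']; split; eapply L_trans; eauto. Qed.

Lemma interderivable_imp phi phi' psi psi' :
  interderivable phi phi' -> interderivable psi psi' ->
  interderivable (phi ~> psi) (phi' ~> psi').
Proof.
intros [D D'] [E E']; split.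
- exact (L_trans (L_Sf _ D') (L_WPf _ E E')).
- exact (L_trans (L_Sf _ D) (L_WPf _ E' E)).
Qed.

(** A choice of one formula per interderivability class replaces the quotient, so that equality in
    the Lindenbaum algebra is Leibniz equality. *)
Definition representative phi : formula :=
  epsilon (inhabits Zero) (interderivable phi).

Lemma representativeP phi : interderivable phi (representative phi).
Proof.
unfold representative; apply epsilon_spec; exists phi; split; apply L_refl.
Qed.

(** Interderivable formulas have extensionally equal classes, and [epsilon] chooses the same element
    from equal predicates. *)
Lemma representative_eq phi psi :
  interderivable phi psi -> representative phi = representative psi.
Proof.
intros E; unfold representative; f_equal.
apply functional_extensionality; intros chi; apply propositional_extensionality.
split; apply interderivable_trans; trivial; now apply interderivable_sym.
Qed.

Definition lindenbaum_carrier : Type :=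
  {phi : formula | representative phi = phi}.

Definition lindenbaum_class phi : lindenbaum_carrier :=
  exist _ (representative phi)
    (eq_sym (representative_eq (representativeP phi))).

Definition lindenbaum : algebra := {|
  carrier := lindenbaum_carrier;
  imp := fun x y => lindenbaum_class (proj1_sig x ~> proj1_sig y);
  zero := lindenbaum_class Zero
|}.

Lemma lindenbaum_class_eq phi psi :
  lindenbaum_class phi = lindenbaum_class psi <-> interderivable phi psi.
Proof.
split.
- intros E; apply (f_equal (@proj1_sig _ _)) in E; simpl in E.
  apply (interderivable_trans (representativeP phi)); rewrite E.
  apply interderivable_sym, representativeP.
- intros E; apply subset_eq_compat; now apply representative_eq.
Qed.

Lemma lindenbaum_class_surj (x : lindenbaum_carrier) :
  lindenbaum_class (proj1_sig x) = x.
Proof. destruct x as [phi E]; now apply subset_eq_compat. Qed.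

Lemma lindenbaum_imp phi psi :
  imp (a := lindenbaum) (lindenbaum_class phi) (lindenbaum_class psi) =
  lindenbaum_class (phi ~> psi).
Proof.
apply lindenbaum_class_eq.
apply interderivable_imp; apply interderivable_sym, representativeP.
Qed.

Lemma lindenbaum_class_one phi :
  lindenbaum_class phi = one (A := lindenbaum) <-> L_LEA Gamma phi.
Proof.
unfold one, compl; simpl zero; rewrite lindenbaum_imp.
rewrite lindenbaum_class_eq; apply interderivable_one.
Qed.

Lemma lindenbaum_eval phi :
  eval (A := lindenbaum) (fun n => lindenbaum_class (Var n)) phi =
  lindenbaum_class phi.
Proof.
induction phi as [n|s IHs t IHt|]; trivial.
rewrite <- lindenbaum_imp.
exact (f_equal2 (imp (a := lindenbaum)) IHs IHt).
Qed.

Lemma lindenbaum_LEA : LEA_algebra lindenbaum.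
Proof.
assert (surj : forall x : lindenbaum, exists phi, x = lindenbaum_class phi)
  by (intros x; exists (proj1_sig x); symmetry; apply lindenbaum_class_surj).
(* With every element written as a class, an equation with [1] on the right becomes derivability,
   and the goals turn into axioms, rules or facts about interderivability. *)
split; intros x;
  try (intros y; destruct (surj y) as [psi ->]);
  try (intros z; destruct (surj z) as [chi ->]);
  destruct (surj x) as [phi ->]; unfold compl; simpl zero;
  rewrite ?lindenbaum_imp, ?lindenbaum_class_one.
- apply L_A1.
- apply L_A2.
- apply L_A3.
- apply L_refl.
- apply L_MP.
- apply L_Sf.
- apply L_R1.
- now intros D E; apply lindenbaum_class_eq.
- apply L_R2.
Qed.

End Lindenbaum.

(** * The equivalent algebraic semantics *)

(** The defining identity reads [x = x ~> x], and [x ~> x] is [1]. *)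
Lemma satisfies_translate (A : algebra) (a : nat -> A) phi :
  LEA_algebra A ->
  satisfies a (translate LEA_delta LEA_epsilon phi) <-> eval a phi = one.
Proof.
intros H; unfold satisfies; simpl; now rewrite (lea_refl H).
Qed.

Lemma LEA_equivalent_algebraic_semantics :
  equivalent_algebraic_semantics
    L_LEA LEA_Delta LEA_delta LEA_epsilon LEA_quasivariety.
Proof.
split.
- intros Gamma phi; split.
  + intros D A HA%LEA_quasivarietyE a Ha.
    apply satisfies_translate; trivial.
    apply (L_LEA_sound D HA); intros psi Hpsi.
    apply satisfies_translate; trivial; apply Ha; now exists psi.
  + intros D.
    assert (HL := lindenbaum_LEA Gamma).
    (* Under the valuation of each variable by its class, a formula has value [1] exactly when
       [Gamma] derives it; in particular all of [Gamma] is satisfied. *)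
    apply lindenbaum_class_one; rewrite <- lindenbaum_eval.
    apply (satisfies_translate _ phi HL).
    apply D; [now apply LEA_quasivarietyE|].
    intros e [psi [Hpsi ->]]; apply satisfies_translate; trivial.
    rewrite lindenbaum_eval; now apply lindenbaum_class_one, L_hyp.
- intros phi psi e [chi [[t [Ht ->]] ->]] A HA%LEA_quasivarietyE a Ha.
  apply satisfies_translate; trivial.
  assert (E : eval a phi = eval a psi) by exact (Ha _ eq_refl).
  destruct Ht as [<-|[<-|[]]]; simpl; rewrite E; apply (lea_refl HA).
- intros phi psi A HA%LEA_quasivarietyE a Ha.
  apply (lea_antisym HA).
  + apply (satisfies_translate a (Imp phi psi) HA), Ha.
    exists (Imp phi psi); split; trivial.
    exists (Imp (Var true) (Var false)); simpl; auto.
  + apply (satisfies_translate a (Imp psi phi) HA), Ha.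
    exists (Imp psi phi); split; trivial.
    exists (Imp (Var false) (Var true)); simpl; auto.
Qed.

Theorem theorem4p3 :
  is_quasivariety LEA_quasivariety /\
  equivalent_algebraic_semantics
    L_LEA LEA_Delta LEA_delta LEA_epsilon LEA_quasivariety /\
  (forall K : algebra -> Prop,
     is_quasivariety K ->
     equivalent_algebraic_semantics L_LEA LEA_Delta LEA_delta LEA_epsilon K ->
     forall A : algebra, K A <-> LEA_quasivariety A) /\
  (forall A : algebra,
     LEA_quasivariety A <-> lattice_effect_implication_algebra A).
Proof.
assert (quasi : is_quasivariety LEA_quasivariety)
  by now exists (fun q => In q LEA_quasiidentities).
assert (eas := LEA_equivalent_algebraic_semantics).
split; [exact quasi|split; [exact eas|split]].
- intros K Kquasi Keas A; split.
  + exact (quasivariety_semantics_sub quasi Keas eas (A := A)).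
  + exact (quasivariety_semantics_sub Kquasi eas Keas (A := A)).
- intros A; rewrite LEA_quasivarietyE; split.
  + apply LEA_algebra_leia.
  + apply leia_LEA_algebra.
Qed.
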